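(* There is a set $B\subseteq\mathbb{N}$ that is both superhigh and jump traceable.
   Context: Let $\{\Phi_n^X\}_{n\in\mathbb{N}}$ be a standard list of all functions partial computable in the oracle $X$, let $W_n^X$ be the domain of $\Phi_n^X$, and let $J^X(n)=\Phi_n^X(n)$. The jump of $X$ is $X'=\{e: J^X(e)\downarrow\}$; $\emptyset''=(\emptyset')'$. A set $X$ is superhigh if $X'\ge_{tt}\emptyset''$, where $\le_{tt}$ is truth-table reducibility. $X$ is jump traceable by $Y$ ($X\le_{JT}Y$) if there are computable functions $f,g$ such that for all $n$, if $J^X(n)\downarrow$ then $J^X(n)\in W_{f(n)}^Y$, and for all $n$, $W_{f(n)}^Y$ is finite of cardinality at most $g(n)$. $X$ is jump traceable if $X\le_{JT}\emptyset$. *)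

(* Defs.v *)
From Stdlib Require Import Arith Cantor Ensembles Finite_sets.

Definition pr (x y : nat) : nat := Cantor.to_nat (x, y).
Definition pr1 (z : nat) : nat := fst (Cantor.of_nat z).
Definition pr2 (z : nat) : nat := snd (Cantor.of_nat z).

Lemma pr_inj x y x' y' : pr x y = pr x' y' -> x = x' /\ y = y'.
Proof. unfold pr; intros H; apply Cantor.to_nat_inj in H; now injection H. Qed.

(** Partial functions are represented by their graphs: [p x y] means that
    [p] converges on [x] with value [y].  Functions of several arguments are
    made unary with the Cantor pairing [pr]. *)
Definition pfun := nat -> nat -> Prop.

(** Kleene's mu-recursive functions relative to an oracle:
    [Prec f g] maps [<a,0>] to [f a] and [<a,n+1>] to [g <a,<n,r>>] where [r]
    is its value at [<a,n>]; [Mu f] maps [a] to the least [n] with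
    [f <a,n> = 0], all the values [f <a,m>], [m < n], being required to
    converge. *)
Inductive code : Set :=
| Oracle | Zero | Succ | Fst | Snd
| Pair (f g : code)
| Comp (f g : code)
| Prec (f g : code)
| Mu (f : code).

Fixpoint eval (X : Ensemble nat) (c : code) : pfun :=
  match c with
  | Oracle => fun x y => (X x /\ y = 1) \/ (~ X x /\ y = 0)
  | Zero => fun _ y => y = 0
  | Succ => fun x y => y = S x
  | Fst => fun x y => y = pr1 x
  | Snd => fun x y => y = pr2 x
  | Pair f g => fun x y =>
      exists u v, eval X f x u /\ eval X g x v /\ y = pr u v
  | Comp f g => fun x y => exists u, eval X g x u /\ eval X f u y
  | Prec f g => fun x =>
      (fix rec (n : nat) : nat -> Prop :=
         match n with
         | 0 => eval X f (pr1 x)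
         | S m => fun y =>
             exists r, rec m r /\ eval X g (pr (pr1 x) (pr m r)) y
         end) (pr2 x)
  | Mu f => fun x n =>
      eval X f (pr x n) 0 /\
      forall m, m < n -> exists k, eval X f (pr x m) (S k)
  end.

Lemma eval_fun X c x y z : eval X c x y -> eval X c x z -> y = z.
Proof.
revert x y z.
induction c as [ | | | | | f IHf g IHg | f IHf g IHg | f IHf g IHg | f IHf];
  intros x y z; cbn [eval]; try congruence.
- intros [[? ?]|[? ?]] [[? ?]|[? ?]]; subst; tauto.
- intros (u & v & Hu & Hv & ->) (u' & v' & Hu' & Hv' & ->).
  now rewrite (IHf _ _ _ Hu Hu'), (IHg _ _ _ Hv Hv').
- intros (u & Hu & Hy) (u' & Hu' & Hz).
  rewrite <- (IHg _ _ _ Hu Hu') in Hz; eauto.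
- revert y z; induction (pr2 x) as [|n IHn]; [now apply IHf|].
  intros y z (r & Hr & Hy) (r' & Hr' & Hz).
  rewrite <- (IHn _ _ Hr Hr') in Hz; eauto.
- intros [Hy Hlty] [Hz Hltz].
  destruct (Nat.lt_trichotomy y z) as [H|[H|H]]; trivial.
  + destruct (Hltz _ H) as [k Hk]; discriminate (IHf _ _ _ Hy Hk).
  + destruct (Hlty _ H) as [k Hk]; discriminate (IHf _ _ _ Hz Hk).
Qed.

Fixpoint code_num (c : code) : nat :=
  match c with
  | Oracle => pr 0 0
  | Zero => pr 1 0
  | Succ => pr 2 0
  | Fst => pr 3 0
  | Snd => pr 4 0
  | Pair f g => pr 5 (pr (code_num f) (code_num g))
  | Comp f g => pr 6 (pr (code_num f) (code_num g))
  | Prec f g => pr 7 (pr (code_num f) (code_num g))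
  | Mu f => pr 8 (code_num f)
  end.

Lemma code_num_inj c d : code_num c = code_num d -> c = d.
Proof.
revert d; induction c; intros []; cbn [code_num]; intros H;
  apply pr_inj in H; destruct H as [Ht H]; try discriminate Ht; trivial;
  try (apply pr_inj in H; destruct H as [H1 H2]); f_equal; auto.
Qed.

(** [Phi X e] is the e-th function partial computable in [X].  A number that
    is not a Gödel number lists the nowhere defined function. *)
Definition Phi (X : Ensemble nat) (e : nat) : pfun :=
  fun x y => exists c, code_num c = e /\ eval X c x y.

Lemma Phi_fun X e x y z : Phi X e x y -> Phi X e x z -> y = z.
Proof.
intros (c & <- & Hy) (d & Hd & Hz).
apply code_num_inj in Hd; subst d; eapply eval_fun; eassumption.
Qed.

Definition W (X : Ensemble nat) (e : nat) : Ensemble nat :=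
  fun x => exists y, Phi X e x y.

Definition J (X : Ensemble nat) : pfun := fun n => Phi X n n.

Definition jump (X : Ensemble nat) : Ensemble nat :=
  fun e => exists y, J X e y.

Definition computable (f : nat -> nat) : Prop :=
  exists e, forall n, Phi (Empty_set nat) e n (f n).

(** Truth-table conditions: propositional formulas in the atoms "[k] belongs
    to the oracle". *)
Inductive tt_cond : Set :=
| TAtom (k : nat)
| TFalse
| TNot (s : tt_cond)
| TAnd (s t : tt_cond)
| TOr (s t : tt_cond).

Fixpoint tt_sat (X : Ensemble nat) (s : tt_cond) : Prop :=
  match s with
  | TAtom k => X k
  | TFalse => False
  | TNot s => ~ tt_sat X s
  | TAnd s t => tt_sat X s /\ tt_sat X t
  | TOr s t => tt_sat X s \/ tt_sat X t
  end.

Fixpoint tt_num (s : tt_cond) : nat :=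
  match s with
  | TAtom k => pr 0 k
  | TFalse => pr 1 0
  | TNot s => pr 2 (tt_num s)
  | TAnd s t => pr 3 (pr (tt_num s) (tt_num t))
  | TOr s t => pr 4 (pr (tt_num s) (tt_num t))
  end.

Lemma tt_num_inj s t : tt_num s = tt_num t -> s = t.
Proof.
revert t; induction s; intros []; cbn [tt_num]; intros H;
  apply pr_inj in H; destruct H as [Ht H]; try discriminate Ht; trivial;
  try (apply pr_inj in H; destruct H as [H1 H2]); f_equal; auto.
Qed.

Definition tt_reducible (A X : Ensemble nat) : Prop :=
  exists s : nat -> tt_cond,
    computable (fun n => tt_num (s n)) /\
    forall n, A n <-> tt_sat X (s n).

Definition superhigh (X : Ensemble nat) : Prop :=
  tt_reducible (jump (jump (Empty_set nat))) (jump X).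

Definition jump_traceable_by (X Y : Ensemble nat) : Prop :=
  exists f g : nat -> nat,
    computable f /\ computable g /\
    (forall n v, J X n v -> W Y (f n) v) /\
    (forall n, exists k, cardinal nat (W Y (f n)) k /\ k <= g n).

Definition jump_traceable (X : Ensemble nat) : Prop :=
  jump_traceable_by X (Empty_set nat).

(* Main.v *)
(** A binary tree of computations is built: a string [r] at level [n] is first
    prolonged by the [n]-th bit to be coded and then, if possible, by the first
    finite string found that makes the [n]-th computation of the jump halt.
    Given the bits and the guesses whether a halting prolongation exists, the
    node at level [n] is partial computable, so the at most [4^(n+1)] values
    found at level [n+1] trace the jump of every path.  For a path [B] coding
    [A], the correct guesses form the lexicographically greatest sequence whose
    node exists and is an initial segment of [B]; this maximum, and the bit of
    [B] following it, are determined by a truth table from questions that are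
    c.e. in [B].  Hence every [A], and in particular the second jump of the
    empty set, is truth-table reducible to the jump of a jump traceable set. *)

Require Import Defs.
From Stdlib Require Import Ensembles.
From Stdlib Require Import Arith Bool Lia Cantor Finite_sets List.
From Stdlib Require Import Classical ClassicalEpsilon.
From Stdlib Require Import FunctionalExtensionality PropExtensionality.

(** * Inverses of the pairing *)

Lemma pr1_pr x y : pr1 (pr x y) = x.
Proof. unfold pr1, pr; now rewrite Cantor.cancel_of_to. Qed.

Lemma pr2_pr x y : pr2 (pr x y) = y.
Proof. unfold pr2, pr; now rewrite Cantor.cancel_of_to. Qed.

Lemma pr_eta z : pr (pr1 z) (pr2 z) = z.
Proof.
unfold pr, pr1, pr2; rewrite <- surjective_pairing; apply Cantor.cancel_to_of.
Qed.

#[local] Opaque pr pr1 pr2.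
#[local] Hint Rewrite pr1_pr pr2_pr pr_eta : pr.

(** * Effective functionals *)

Definition decides (b : nat -> bool) (X : Ensemble nat) : Prop :=
  forall k, X k <-> b k = true.

(** The code is chosen before the oracle, so one program serves all oracles uniformly. The Boolean
    oracle [b] beside the set [X] lets functionals be written as ordinary terms. *)
Definition effective (F : (nat -> bool) -> nat -> nat) : Prop :=
  exists c, forall b X, decides b X -> forall x, eval X c x (F b x).

Lemma effective_ext F G :
  (forall b x, F b x = G b x) -> effective F -> effective G.
Proof.
intros E [c Hc]; exists c; intros b X HX x; rewrite <- E; now apply Hc.
Qed.

Definition Id := Pair Fst Snd.

Lemma eval_Id X x y : eval X Id x y <-> y = x.
Proof.
cbn; split.
- intros (u & v & -> & -> & ->); apply pr_eta.
- intros ->; exists (pr1 x), (pr2 x); now rewrite pr_eta.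
Qed.

Fixpoint const (n : nat) : code :=
  match n with 0 => Zero | S n => Comp Succ (const n) end.

Lemma eval_const X n x y : eval X (const n) x y <-> y = n.
Proof.
revert y; induction n as [|n IH]; intros y; cbn; [tauto|].
split; [intros (u & Hu & ->)|intros ->; exists n].
- now apply IH in Hu as ->.
- split; trivial; now apply IH.
Qed.

Lemma eval_Prec X f g a F0 G n :
  eval X f a F0 -> (forall m r, eval X g (pr a (pr m r)) (G m r)) ->
  eval X (Prec f g) (pr a n) (nat_rect (fun _ => nat) F0 G n).
Proof.
intros H0 HS; cbn; rewrite pr1_pr, pr2_pr.
induction n as [|n IH]; cbn; eauto.
Qed.

(* With constants opaque, [auto] decomposes a functional along its visible syntax only, so that
   effectiveness proofs follow the way the term is written. *)
Create HintDb eff.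
#[local] Hint Constants Opaque : eff.

Lemma effective_id : effective (fun _ x => x).
Proof. exists Id; intros; now apply eval_Id. Qed.

Lemma effective_const n : effective (fun _ _ => n).
Proof. exists (const n); intros; now apply eval_const. Qed.

Lemma effective_comp F G :
  effective F -> effective G -> effective (fun b x => F b (G b x)).
Proof.
intros [f Hf] [g Hg]; exists (Comp f g); intros b X HX x; cbn; eauto.
Qed.

Lemma effective_oracle F :
  effective F -> effective (fun b x => Nat.b2n (b (F b x))).
Proof.
apply effective_comp with (F := fun b x => Nat.b2n (b x)).
exists Oracle; intros b X HX x; cbn.
generalize (HX x); destruct (b x); intros H; [left|right]; split; trivial;
  rewrite H; easy.
Qed.

Lemma effective_S F : effective F -> effective (fun b x => S (F b x)).
Proof. apply effective_comp with (F := fun _ => S); exists Succ; now cbn. Qed.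

Lemma effective_pr1 F : effective F -> effective (fun b x => pr1 (F b x)).
Proof. apply effective_comp with (F := fun _ => pr1); exists Fst; now cbn. Qed.

Lemma effective_pr2 F : effective F -> effective (fun b x => pr2 (F b x)).
Proof. apply effective_comp with (F := fun _ => pr2); exists Snd; now cbn. Qed.

Lemma effective_pr F G :
  effective F -> effective G -> effective (fun b x => pr (F b x) (G b x)).
Proof.
intros [f Hf] [g Hg]; exists (Pair f g); intros b X HX x; cbn.
exists (F b x), (G b x); auto.
Qed.

#[local] Hint Resolve effective_id effective_const effective_oracle effective_S
  effective_pr1 effective_pr2 effective_pr : eff.

Lemma effective_rec F G N :
  effective F ->
  effective (fun b z => G b (pr1 z) (pr1 (pr2 z)) (pr2 (pr2 z))) ->
  effective N ->
  effective (fun b x => nat_rect (fun _ => nat) (F b x) (G b x) (N b x)).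
Proof.
intros [f Hf] [g Hg] HN.
assert (H : effective (fun b z =>
  nat_rect (fun _ => nat) (F b (pr1 z)) (G b (pr1 z)) (pr2 z))).
{ exists (Prec f g); intros b X HX z; rewrite <- (pr_eta z) at 1.
  apply eval_Prec; [now apply Hf|].
  intros m r; generalize (Hg b X HX (pr (pr1 z) (pr m r))).
  now autorewrite with pr. }
eapply effective_ext;
  [|apply (effective_comp _ _ H (effective_pr _ _ effective_id HN))].
intros b x; cbn; now autorewrite with pr.
Qed.

Lemma effective_iter F G N :
  effective (fun b z => G b (pr1 z) (pr2 z)) -> effective F -> effective N ->
  effective (fun b x => Nat.iter (N b x) (G b x) (F b x)).
Proof.
intros HG HF HN.
apply effective_rec with (G := fun b x _ => G b x); trivial.
eapply effective_ext; [|apply (effective_comp _ (fun _ z => pr (pr1 z) (pr2 (pr2 z))) HG)];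
  [|auto 10 with eff].
intros b x; cbn; now autorewrite with pr.
Qed.

Lemma effective_if P F G :
  effective (fun b x => Nat.b2n (P b x)) -> effective F -> effective G ->
  effective (fun b x => if P b x then F b x else G b x).
Proof.
intros HP HF HG.
apply effective_ext with
  (fun b x => nat_rect (fun _ => nat) (G b x) (fun _ _ => F b x) (Nat.b2n (P b x))).
- intros b x; now destruct (P b x).
- apply effective_rec with (G := fun b x _ _ => F b x); trivial.
  apply (effective_comp F (fun _ z => pr1 z)); auto with eff.
Qed.

#[local] Hint Resolve effective_if : eff.

Lemma effective_negb P :
  effective (fun b x => Nat.b2n (P b x)) ->
  effective (fun b x => Nat.b2n (negb (P b x))).
Proof.
intros HP; apply effective_ext with (fun b x => if P b x then 0 else 1);
  [intros b x; now destruct (P b x)|auto with eff].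
Qed.

Lemma effective_andb P Q :
  effective (fun b x => Nat.b2n (P b x)) ->
  effective (fun b x => Nat.b2n (Q b x)) ->
  effective (fun b x => Nat.b2n (P b x && Q b x)).
Proof.
intros HP HQ; apply effective_ext with (fun b x => if P b x then Nat.b2n (Q b x) else 0);
  [intros b x; now destruct (P b x)|auto with eff].
Qed.

#[local] Hint Resolve effective_negb effective_andb : eff.

Lemma effective_xorb P Q :
  effective (fun b x => Nat.b2n (P b x)) ->
  effective (fun b x => Nat.b2n (Q b x)) ->
  effective (fun b x => Nat.b2n (xorb (P b x) (Q b x))).
Proof.
intros HP HQ; apply effective_ext with
  (fun b x => if P b x then Nat.b2n (negb (Q b x)) else Nat.b2n (Q b x));
  [intros b x; now destruct (P b x), (Q b x)|auto with eff].
Qed.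

Lemma effective_pred F : effective F -> effective (fun b x => Nat.pred (F b x)).
Proof.
intros HF; apply effective_ext with
  (fun b x => nat_rect (fun _ => nat) 0 (fun m _ => m) (F b x)).
- intros b x; now destruct (F b x).
- apply effective_rec with (F := fun _ _ => 0) (G := fun _ _ m _ => m);
    auto with eff.
Qed.

Lemma effective_eqb0 F :
  effective F -> effective (fun b x => Nat.b2n (F b x =? 0)).
Proof.
intros HF; apply effective_ext with
  (fun b x => nat_rect (fun _ => nat) 1 (fun _ _ => 0) (F b x)).
- intros b x; now destruct (F b x).
- apply effective_rec with (F := fun _ _ => 1) (G := fun _ _ _ _ => 0);
    auto with eff.
Qed.

#[local] Hint Resolve effective_xorb effective_pred effective_eqb0 : eff.

Lemma effective_sub F G :
  effective F -> effective G -> effective (fun b x => F b x - G b x).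
Proof.
intros HF HG; apply effective_ext with (fun b x => Nat.iter (G b x) Nat.pred (F b x)).
- intros b x; induction (G b x) as [|m IH]; [cbn; lia|rewrite Nat.iter_succ, IH; lia].
- apply effective_iter with (G := fun _ _ => Nat.pred); auto with eff.
Qed.

#[local] Hint Resolve effective_sub : eff.

Lemma effective_leb F G :
  effective F -> effective G -> effective (fun b x => Nat.b2n (F b x <=? G b x)).
Proof.
intros HF HG; apply effective_ext with (fun b x => Nat.b2n (F b x - G b x =? 0));
  [|auto with eff].
intros b x; f_equal; apply eq_true_iff_eq; rewrite Nat.eqb_eq, Nat.leb_le; lia.
Qed.

Lemma effective_ltb F G :
  effective F -> effective G -> effective (fun b x => Nat.b2n (F b x <? G b x)).
Proof. intros HF HG; apply effective_leb; auto with eff. Qed.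

#[local] Hint Resolve effective_leb effective_ltb : eff.

Lemma effective_eqb F G :
  effective F -> effective G -> effective (fun b x => Nat.b2n (F b x =? G b x)).
Proof.
intros HF HG; apply effective_ext with
  (fun b x => Nat.b2n ((F b x <=? G b x) && (G b x <=? F b x))); [|auto with eff].
intros b x; f_equal; apply eq_true_iff_eq.
rewrite andb_true_iff, Nat.eqb_eq, !Nat.leb_le; lia.
Qed.

Lemma effective_odd F :
  effective F -> effective (fun b x => Nat.b2n (Nat.odd (F b x))).
Proof.
intros HF; apply effective_ext with
  (fun b x => Nat.iter (F b x) (fun r => 1 - r) 0).
- intros b x; induction (F b x) as [|m IH]; trivial.
  rewrite Nat.iter_succ, IH, Nat.odd_succ, <- Nat.negb_odd; now destruct (Nat.odd m).
- apply effective_iter with (G := fun _ _ r => 1 - r) (F := fun _ _ => 0);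
    auto with eff.
Qed.

#[local] Hint Resolve effective_eqb effective_odd : eff.

Lemma effective_add F G :
  effective F -> effective G -> effective (fun b x => F b x + G b x).
Proof.
intros HF HG; apply effective_ext with (fun b x => Nat.iter (F b x) S (G b x)).
- intros b x; induction (F b x) as [|m IH]; trivial; rewrite Nat.iter_succ, IH; lia.
- apply effective_iter with (G := fun _ _ => S); auto with eff.
Qed.

#[local] Hint Resolve effective_add : eff.

Lemma effective_div2 F : effective F -> effective (fun b x => Nat.div2 (F b x)).
Proof.
intros HF; apply effective_ext with
  (* Halving grows by one exactly when an odd [m] is passed to [S m]. *)
  (fun b x => nat_rect (fun _ => nat) 0 (fun m r => Nat.b2n (Nat.odd m) + r) (F b x)).
- intros b x; induction (F b x) as [|m IH]; cbn [nat_rect]; trivial.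
  rewrite IH; generalize (Nat.div2_odd m) (Nat.div2_odd (S m)).
  rewrite Nat.odd_succ, <- Nat.negb_odd; destruct (Nat.odd m);
  cbn [negb Nat.b2n]; lia.
- apply effective_rec with (F := fun _ _ => 0)
    (G := fun _ _ m r => Nat.b2n (Nat.odd m) + r); auto 10 with eff.
Qed.

Lemma effective_pow2 F : effective F -> effective (fun b x => 2 ^ F b x).
Proof.
intros HF; apply effective_ext with (fun b x => Nat.iter (F b x) (fun r => r + r) 1).
- intros b x; induction (F b x) as [|m IH]; trivial.
  rewrite Nat.iter_succ, IH; cbn; lia.
- apply effective_iter with (G := fun _ _ r => r + r) (F := fun _ _ => 1);
    auto with eff.
Qed.

#[local] Hint Resolve effective_div2 effective_pow2 : eff.

(** The least [z < t] with [p z], shifted by one; [0] if there is none. *)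
Definition bmin (p : nat -> bool) (t : nat) : nat :=
  nat_rect (fun _ => nat) 0
    (fun m r => if r =? 0 then if p m then S m else 0 else r) t.

Lemma effective_bmin P N :
  effective (fun b z => Nat.b2n (P b (pr1 z) (pr2 z))) -> effective N ->
  effective (fun b x => bmin (P b x) (N b x)).
Proof.
intros HP HN; apply effective_rec with (F := fun _ _ => 0)
  (G := fun b x m r => if r =? 0 then if P b x m then S m else 0 else r);
  [auto with eff| |trivial].
assert (H := effective_comp _ (fun _ z => pr (pr1 z) (pr1 (pr2 z))) HP).
cbn in H; apply effective_ext with (G := fun b z =>
  Nat.b2n (P b (pr1 z) (pr1 (pr2 z)))) in H; [|intros; now autorewrite with pr|auto 10 with eff].
auto 10 with eff.
Qed.

Lemma bmin_S p t z : bmin p t = S z -> p z = true.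
Proof.
induction t as [|t IH]; cbn; [easy|].
fold (bmin p t); destruct (bmin p t); cbn; [|exact IH].
destruct (p t) eqn:E; congruence.
Qed.

Lemma bmin_0 p t : bmin p t = 0 <-> forall z, z < t -> p z = false.
Proof.
induction t as [|t IH]; cbn; [split; [lia|trivial]|].
fold (bmin p t); destruct (bmin p t) as [|z] eqn:E; cbn.
- destruct IH as [IH _]; specialize (IH eq_refl); split.
  + intros H z Hz; destruct (Nat.eq_dec z t) as [->|]; [|apply IH; lia].
    now destruct (p t).
  + intros H; now rewrite H by lia.
- split; [easy|]; intros H; apply IH; intros; apply H; lia.
Qed.

Lemma bmin_least p t z : bmin p t = S z -> forall m, m < z -> p m = false.
Proof.
induction t as [|t IH]; cbn; [easy|].
fold (bmin p t); destruct (bmin p t) as [|z'] eqn:E; cbn; [|exact IH].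
destruct (p t); [intros [= <-]; now apply bmin_0|easy].
Qed.

Lemma bmin_mono p t t' z : t <= t' -> bmin p t = S z -> bmin p t' = S z.
Proof.
intros Ht Hz; induction Ht as [|t' _ IH]; trivial.
cbn; fold (bmin p t'); now rewrite IH.
Qed.

Lemma bmin_unique p t t' z z' : bmin p t = S z -> bmin p t' = S z' -> z = z'.
Proof.
intros H H'; destruct (Nat.le_ge_cases t t') as [L|L];
  [apply (bmin_mono _ _ _ _ L) in H|apply (bmin_mono _ _ _ _ L) in H']; congruence.
Qed.

(** An unbounded search halts exactly when a witness exists. [Mu] looks for a zero, hence the
    negation of [P]; [bmin] supplies the least witness that [Mu] demands. *)
Lemma effective_exists P :
  effective (fun b z => Nat.b2n (P b (pr1 z) (pr2 z))) ->
  exists c, forall b X, decides b X -> forall x,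
    (exists y, eval X c x y) <-> exists z, P b x z = true.
Proof.
intros HP; apply effective_negb with (P := fun b z => P b (pr1 z) (pr2 z)) in HP.
destruct HP as [c Hc]; exists (Mu c); intros b X HX x.
assert (E : forall z, eval X c (pr x z) (Nat.b2n (negb (P b x z)))).
{ intros z; generalize (Hc b X HX (pr x z)); now autorewrite with pr. }
cbn; split.
- intros (z & Hz & _); exists z.
  generalize (eval_fun _ _ _ _ _ Hz (E z)); now destruct (P b x z).
- intros [z Hz].
  assert (N : bmin (P b x) (S z) <> 0).
  { rewrite bmin_0; intros H; rewrite H in Hz; [easy|lia]. }
  destruct (bmin (P b x) (S z)) as [|y] eqn:Ey; [easy|]; exists y; split.
  + generalize (E y); now rewrite (bmin_S _ _ _ Ey).
  + intros m Hm; exists 0; generalize (E m); now rewrite (bmin_least _ _ _ Ey m Hm).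
Qed.

(** * Finite oracles *)

(** The number [pr l s] stands for the binary string of length [l] whose last
    bit is [pr1 s], the remaining ones being stored in the same way in [pr2 s];
    thus [pr2] deletes the last bit.  Every nonzero entry counts as a 1. *)
Definition bit (r k : nat) : bool :=
  negb (pr1 (Nat.iter (pr1 r - S k) pr2 (pr2 r)) =? 0).

Definition snoc (r : nat) (a : bool) : nat := pr (S (pr1 r)) (pr (Nat.b2n a) (pr2 r)).

Definition ext (r r' : nat) : bool :=
  (pr1 r <=? pr1 r') && (Nat.iter (pr1 r' - pr1 r) pr2 (pr2 r') =? pr2 r).

Definition segment (b : nat -> bool) (r : nat) : bool :=
  bmin (fun k => xorb (bit r k) (b k)) (pr1 r) =? 0.

Lemma extP r r' :
  ext r r' = true <->
  pr1 r <= pr1 r' /\ Nat.iter (pr1 r' - pr1 r) pr2 (pr2 r') = pr2 r.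
Proof. unfold ext; now rewrite andb_true_iff, Nat.leb_le, Nat.eqb_eq. Qed.

Lemma segmentP b r :
  segment b r = true <-> forall k, k < pr1 r -> bit r k = b k.
Proof.
unfold segment; rewrite Nat.eqb_eq, bmin_0.
split; intros H k Hk; specialize (H k Hk); now destruct (bit r k), (b k).
Qed.

Lemma ext_refl r : ext r r = true.
Proof. apply extP; now rewrite Nat.sub_diag. Qed.

Lemma ext_trans r r' r'' : ext r r' = true -> ext r' r'' = true -> ext r r'' = true.
Proof.
rewrite !extP; intros [H1 H2] [H3 H4]; split; [lia|].
replace (pr1 r'' - pr1 r) with ((pr1 r' - pr1 r) + (pr1 r'' - pr1 r')) by lia.
now rewrite Nat.iter_add, H4.
Qed.

Lemma ext_bit r r' k : ext r r' = true -> k < pr1 r -> bit r' k = bit r k.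
Proof.
rewrite extP; intros [H1 H2] Hk; unfold bit; rewrite <- H2, <- Nat.iter_add.
now replace (pr1 r - S k + (pr1 r' - pr1 r)) with (pr1 r' - S k) by lia.
Qed.

Lemma ext_segment b r r' : ext r r' = true -> segment b r' = true -> segment b r = true.
Proof.
intros He; rewrite !segmentP; intros H k Hk; rewrite <- (ext_bit _ _ _ He Hk).
apply H; apply extP in He; lia.
Qed.

Lemma length_snoc r a : pr1 (snoc r a) = S (pr1 r).
Proof. apply pr1_pr. Qed.

Lemma ext_snoc r a : ext r (snoc r a) = true.
Proof.
apply extP; rewrite length_snoc; split; [lia|].
replace (S (pr1 r) - pr1 r) with 1 by lia; cbn; unfold snoc.
now rewrite !pr2_pr.
Qed.

Lemma bit_snoc r a : bit (snoc r a) (pr1 r) = a.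
Proof.
unfold bit; rewrite length_snoc, Nat.sub_diag; cbn; unfold snoc.
rewrite pr2_pr, pr1_pr; now destruct a.
Qed.

Lemma segment_snoc b r a :
  segment b (snoc r a) = segment b r && negb (xorb a (b (pr1 r))).
Proof.
apply eq_true_iff_eq; rewrite andb_true_iff, !segmentP, length_snoc; split.
- intros H; split.
  + intros k Hk; rewrite <- (ext_bit _ _ _ (ext_snoc r a) Hk); apply H; lia.
  + rewrite <- (H (pr1 r)), bit_snoc by lia; now destruct a.
- intros [H Ha] k Hk; destruct (Nat.eq_dec k (pr1 r)) as [->|].
  + rewrite bit_snoc; now destruct a, (b (pr1 r)).
  + rewrite (ext_bit r) by (apply ext_snoc || lia); apply H; lia.
Qed.

Lemma effective_bit F G :
  effective F -> effective G -> effective (fun b x => Nat.b2n (bit (F b x) (G b x))).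
Proof.
intros HF HG; unfold bit.
assert (H : effective (fun b x =>
  Nat.iter (pr1 (F b x) - S (G b x)) pr2 (pr2 (F b x)))); [|auto with eff].
apply effective_iter with (G := fun _ _ => pr2); auto with eff.
Qed.

Lemma effective_snoc F P :
  effective F -> effective (fun b x => Nat.b2n (P b x)) ->
  effective (fun b x => snoc (F b x) (P b x)).
Proof. unfold snoc; auto with eff. Qed.

Lemma effective_ext_string F G :
  effective F -> effective G -> effective (fun b x => Nat.b2n (ext (F b x) (G b x))).
Proof.
intros HF HG; unfold ext.
assert (H : effective (fun b x =>
  Nat.iter (pr1 (G b x) - pr1 (F b x)) pr2 (pr2 (G b x)))); [|auto with eff].
apply effective_iter with (G := fun _ _ => pr2); auto with eff.
Qed.

#[local] Hint Resolve effective_bit effective_snoc effective_ext_string : eff.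

Lemma effective_segment F :
  effective F -> effective (fun b x => Nat.b2n (segment b (F b x))).
Proof.
intros HF; apply effective_eqb0, effective_bmin; [|auto with eff].
assert (H := effective_comp _ (fun _ => pr1) HF); auto 10 with eff.
Qed.

#[local] Hint Resolve effective_segment : eff.

(** * A universal machine *)

(** A configuration is a current value paired with a stack of tasks.  A task is
    a code, to be applied to the current value, or one of the four
    continuations with tags 9 (second component of a pair), 10 (pairing),
    11 (step of a primitive recursion) and 12 (test in a minimization).
    A machine that queries its finite oracle beyond its length is stuck. *)
Definition push (i K : nat) : nat := S (pr i K).

Definition perform (r x t p K c : nat) : nat :=
  if t =? 0 then if x <? pr1 r then pr (Nat.b2n (bit r x)) K else c
  else if t =? 1 then pr 0 K
  else if t =? 2 then pr (S x) K
  else if t =? 3 then pr (pr1 x) K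
  else if t =? 4 then pr (pr2 x) K
  else if t =? 5 then pr x (push (pr1 p) (push (pr 9 (pr x (pr2 p))) K))
  else if t =? 6 then pr x (push (pr2 p) (push (pr1 p) K))
  else if t =? 7 then
    if pr2 x =? 0 then pr (pr1 x) (push (pr1 p) K)
    else pr (pr (pr1 x) (Nat.pred (pr2 x)))
      (push (pr 7 p)
        (push (pr 11 (pr (pr2 p) (pr (pr1 x) (Nat.pred (pr2 x))))) K))
  else if t =? 8 then pr (pr x 0) (push p (push (pr 12 (pr p (pr x 0))) K))
  else if t =? 9 then pr (pr1 p) (push (pr2 p) (push (pr 10 x) K))
  else if t =? 10 then pr (pr p x) K
  else if t =? 11 then
    pr (pr (pr1 (pr2 p)) (pr (pr2 (pr2 p)) x)) (push (pr1 p) K)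
  else if x =? 0 then pr (pr2 (pr2 p)) K
  else pr (pr (pr1 (pr2 p)) (S (pr2 (pr2 p))))
    (push (pr1 p) (push (pr 12 (pr (pr1 p) (pr (pr1 (pr2 p)) (S (pr2 (pr2 p)))))) K)).

(** The empty task stack is 0, a value that [push] never takes. *)
Definition halted (c : nat) : bool := pr2 c =? 0.

Definition step (r c : nat) : nat :=
  if halted c then c
  else let i := pr1 (Nat.pred (pr2 c)) in
    perform r (pr1 c) (pr1 i) (pr2 i) (pr2 (Nat.pred (pr2 c))) c.

Definition run (r s c : nat) : nat := Nat.iter s (step r) c.

Lemma step_push r x t p K :
  step r (pr x (push (pr t p) K)) = perform r x t p K (pr x (push (pr t p) K)).
Proof. unfold step, halted, push; rewrite pr2_pr; cbn; now autorewrite with pr. Qed.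

Lemma run_halted r s c : halted c = true -> run r s c = c.
Proof.
intros H; induction s as [|s IH]; trivial.
unfold run in *; rewrite Nat.iter_succ, IH; unfold step; now rewrite H.
Qed.

Lemma run_unique r s s' c :
  halted (run r s c) = true -> halted (run r s' c) = true ->
  run r s c = run r s' c.
Proof.
intros H H'; transitivity (run r (s' + s) c); [symmetry|rewrite Nat.add_comm];
  unfold run; rewrite Nat.iter_add; now apply run_halted.
Qed.

(** Only a query reads the string. Within the length of [r] both strings answer alike; beyond it the
    machine with [r] is stuck without having halted. *)
Lemma step_ext r r' c :
  ext r r' = true ->
  step r' c = step r c \/ step r c = c /\ halted c = false.
Proof.
intros He; unfold step; destruct (halted c); [now left|]; cbv zeta.
unfold perform; destruct (pr1 (pr1 (Nat.pred (pr2 c))) =? 0); [|now left].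
destruct (Nat.ltb_spec (pr1 c) (pr1 r)) as [L|L]; [|now right].
left; rewrite (ext_bit _ _ _ He L); apply extP in He.
now rewrite (proj2 (Nat.ltb_lt _ _)) by lia.
Qed.

Lemma run_ext r r' s c :
  ext r r' = true -> halted (run r s c) = true -> run r' s c = run r s c.
Proof.
intros He; revert c; induction s as [|s IH]; intros c; [reflexivity|].
assert (S_run : forall q, run q (S s) c = run q s (step q c))
  by (intros q; apply Nat.iter_succ_r).
rewrite !S_run; intros H.
destruct (step_ext _ _ c He) as [E|[E N]]; [rewrite E; apply IH, H|exfalso].
(* A stuck configuration repeats forever, against the halting of the run with [r]. *)
assert (Hs : forall m, run r m c = c).
{ intros m; induction m as [|m IHm]; [reflexivity|].
  unfold run in *; now rewrite Nat.iter_succ, IHm. }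
rewrite E, Hs, N in H; discriminate H.
Qed.

Definition reach (r c c' : nat) : Prop := exists s, run r s c = c'.

Lemma reach_refl r c : reach r c c.
Proof. now exists 0. Qed.

Lemma reach_trans r c c' c'' : reach r c c' -> reach r c' c'' -> reach r c c''.
Proof.
intros [s <-] [s' <-]; exists (s' + s); unfold run; apply Nat.iter_add.
Qed.

Lemma reach_perform r x t p K c :
  reach r (perform r x t p K (pr x (push (pr t p) K))) c ->
  reach r (pr x (push (pr t p) K)) c.
Proof.
apply reach_trans; exists 1; apply step_push.
Qed.

(** [L] bounds the use of the computation. The arbitrary stack [K] lets subcomputations be chained
    inside larger ones. *)
Definition evaluates (b : nat -> bool) (e x y : nat) : Prop :=
  exists L, forall r, segment b r = true -> L <= pr1 r -> forall K,
    reach r (pr x (push e K)) (pr y K).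

Ltac perform :=
  apply reach_perform; unfold perform; cbn [Nat.eqb Nat.pred];
  autorewrite with pr; cbn [Nat.eqb Nat.pred].

Lemma eval_evaluates b X c x y :
  decides b X -> eval X c x y -> evaluates b (code_num c) x y.
Proof.
intros HX; revert x y.
induction c as [ | | | | | f IHf g IHg | f IHf g IHg | f IHf g IHg | f IHf];
  intros x y; cbn [eval code_num].
- intros H; exists (S x); intros r Hr L K; perform.
  rewrite (proj2 (Nat.ltb_lt _ _)) by lia.
  rewrite segmentP in Hr; rewrite Hr by lia.
  rewrite (HX x) in H; destruct (b x), H as [[? ->]|[? ->]];
    congruence || apply reach_refl.
- intros ->; exists 0; intros r _ _ K; perform; apply reach_refl.
- intros ->; exists 0; intros r _ _ K; perform; apply reach_refl.
- intros ->; exists 0; intros r _ _ K; perform; apply reach_refl.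
- intros ->; exists 0; intros r _ _ K; perform; apply reach_refl.
- intros (u & v & Hu & Hv & ->).
  destruct (IHf _ _ Hu) as [L HL], (IHg _ _ Hv) as [L' HL'].
  (* The sum of the uses serves as an upper bound of both. *)
  exists (L + L'); intros r Hr Lr K; perform.
  eapply reach_trans; [apply HL; trivial; lia|]; perform.
  eapply reach_trans; [apply HL'; trivial; lia|]; perform; apply reach_refl.
- intros (u & Hu & Hy).
  destruct (IHg _ _ Hu) as [L HL], (IHf _ _ Hy) as [L' HL'].
  exists (L + L'); intros r Hr Lr K; perform.
  eapply reach_trans; [apply HL; trivial; lia|]; apply HL'; trivial; lia.
- rewrite <- (pr_eta x) at 2; generalize (pr1 x) (pr2 x); intros a n.
  revert y; induction n as [|n IHn]; intros y.
  + intros Hy; destruct (IHf _ _ Hy) as [L HL].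
    exists L; intros r Hr Lr K; perform; now apply HL.
  + intros (u & Hu & Hy).
    destruct (IHn _ Hu) as [L HL], (IHg _ _ Hy) as [L' HL'].
    exists (L + L'); intros r Hr Lr K; perform.
    eapply reach_trans; [apply HL; trivial; lia|]; perform.
    apply HL'; trivial; lia.
- intros [H0 HS].
  (* Induction on the distance [m] from the candidate under test to the least zero [y], that is,
     backwards along the search. *)
  assert (H : forall m, m <= y -> exists L, forall r,
    segment b r = true -> L <= pr1 r -> forall K,
    reach r (pr (pr x (y - m)) (push (code_num f)
      (push (pr 12 (pr (code_num f) (pr x (y - m)))) K))) (pr y K)).
  { intros m; induction m as [|m IHm]; intros Hm.
    - rewrite Nat.sub_0_r; destruct (IHf _ _ H0) as [L HL].
      exists L; intros r Hr Lr K.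
      eapply reach_trans; [now apply HL|]; perform; apply reach_refl.
    - destruct IHm as [L HL]; [lia|].
      destruct (HS (y - S m)) as [k Hk]; [lia|].
      destruct (IHf _ _ Hk) as [L' HL'].
      exists (L + L'); intros r Hr Lr K.
      eapply reach_trans; [apply HL'; trivial; lia|]; perform.
      replace (S (y - S m)) with (y - m) by lia; apply HL; trivial; lia. }
  destruct (H y (le_n y)) as [L HL]; exists L; intros r Hr Lr K; perform.
  rewrite Nat.sub_diag in HL; now apply HL.
Qed.

Lemma effective_push F G :
  effective F -> effective G -> effective (fun b x => push (F b x) (G b x)).
Proof. unfold push; auto with eff. Qed.

#[local] Hint Resolve effective_push : eff.

Lemma effective_perform R F T P K C :
  effective R -> effective F -> effective T -> effective P -> effective K ->
  effective C ->
  effective (fun b x =>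
    perform (R b x) (F b x) (T b x) (P b x) (K b x) (C b x)).
Proof. intros; unfold perform; auto 40 with eff. Qed.

Lemma effective_halted F :
  effective F -> effective (fun b x => Nat.b2n (halted (F b x))).
Proof. unfold halted; auto with eff. Qed.

#[local] Hint Resolve effective_perform effective_halted : eff.

Lemma effective_step R F :
  effective R -> effective F -> effective (fun b x => step (R b x) (F b x)).
Proof. unfold step; cbv zeta; auto 20 with eff. Qed.

#[local] Hint Resolve effective_step : eff.

Lemma effective_run R N F :
  effective R -> effective N -> effective F ->
  effective (fun b x => run (R b x) (N b x) (F b x)).
Proof.
intros HR HN HF; apply effective_iter with (G := fun b x => step (R b x)); trivial.
apply effective_step; [|auto with eff].
apply (effective_comp R (fun _ => pr1)); auto with eff.
Qed.

#[local] Hint Resolve effective_run : eff.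

(** * The construction *)

Definition init (i : nat) : nat := pr i (push i 0).

(** A witness pairs a prolongation of [r] with a number of steps, so a single bounded search
    dovetails over both. *)
Definition search (t i r : nat) : nat :=
  bmin (fun z => ext r (pr1 z) && halted (run (pr1 z) (pr2 z) (init i))) t.

Definition grow (t i g : nat) (a d : bool) : nat :=
  if g =? 0 then 0
  else let r := snoc (Nat.pred g) a in
    if d then
      if search t i r =? 0 then 0 else S (pr1 (Nat.pred (search t i r)))
    else S r.

(** The binary digits of [a] (the bits to be coded) and of [d] (the guesses as
    to whether the computations can be made to halt) are used from the most
    significant one on; the value [0] means undefined at stage [t]. *)
Fixpoint approx (t n a d : nat) : nat :=
  match n with
  | 0 => S (pr 0 0)
  | S n => grow t n (approx t n (Nat.div2 a) (Nat.div2 d)) (Nat.odd a) (Nat.odd d)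
  end.

Lemma effective_search T I R :
  effective T -> effective I -> effective R ->
  effective (fun b x => search (T b x) (I b x) (R b x)).
Proof.
intros HT HI HR; unfold search, init; apply effective_bmin with (P := fun b x z =>
  ext (R b x) (pr1 z) && halted (run (pr1 z) (pr2 z) (pr (I b x) (push (I b x) 0))));
  trivial.
assert (HI' := effective_comp I (fun _ => pr1) HI).
assert (HR' := effective_comp R (fun _ => pr1) HR).
auto 20 with eff.
Qed.

#[local] Hint Resolve effective_search : eff.

Lemma effective_grow T I F P Q :
  effective T -> effective I -> effective F ->
  effective (fun b x => Nat.b2n (P b x)) ->
  effective (fun b x => Nat.b2n (Q b x)) ->
  effective (fun b x => grow (T b x) (I b x) (F b x) (P b x) (Q b x)).
Proof. intros; unfold grow; cbv zeta; auto 20 with eff. Qed.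

#[local] Hint Resolve effective_grow : eff.

(** [approx] changes its digit arguments at each level. Reading the digits by position keeps [a] and
    [d] fixed, as primitive recursion with parameters requires. *)
Lemma approx_rec t n a d :
  approx t n a d = nat_rect (fun _ => nat) (S (pr 0 0))
    (fun i g => grow t i g (Nat.odd (Nat.iter (n - S i) Nat.div2 a))
                           (Nat.odd (Nat.iter (n - S i) Nat.div2 d))) n.
Proof.
set (h := fun i g => grow t i g _ _).
enough (H : forall i, i <= n ->
  approx t i (Nat.iter (n - i) Nat.div2 a) (Nat.iter (n - i) Nat.div2 d)
  = nat_rect (fun _ => nat) (S (pr 0 0)) h i).
{ rewrite <- H, Nat.sub_diag by lia; reflexivity. }
intros i; induction i as [|i IH]; intros Hi; [reflexivity|].
cbn [approx nat_rect]; rewrite <- IH by lia; unfold h.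
rewrite <- !Nat.iter_succ; now replace (S (n - S i)) with (n - i) by lia.
Qed.

Lemma effective_approx T N F D :
  effective T -> effective N -> effective F -> effective D ->
  effective (fun b x => approx (T b x) (N b x) (F b x) (D b x)).
Proof.
intros HT HN HF HD; eapply effective_ext; [intros b x; symmetry; apply approx_rec|].
assert (HT' := effective_comp T (fun _ => pr1) HT).
assert (H : forall G, effective G -> effective (fun b z =>
  Nat.iter (N b (pr1 z) - S (pr1 (pr2 z))) Nat.div2 (G b (pr1 z)))).
{ intros G HG; apply effective_iter with (G := fun _ _ => Nat.div2);
    [auto with eff| |].
  - apply (effective_comp G (fun _ => pr1)); auto with eff.
  - assert (HN' := effective_comp N (fun _ => pr1) HN); auto 10 with eff. }
apply effective_rec with (F := fun _ _ => S (pr 0 0)) (G := fun b x i g =>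
  grow (T b x) i g (Nat.odd (Nat.iter (N b x - S i) Nat.div2 (F b x)))
                   (Nat.odd (Nat.iter (N b x - S i) Nat.div2 (D b x))));
  [auto with eff| |trivial].
auto 20 with eff.
Qed.

#[local] Hint Resolve effective_approx : eff.

Lemma search_S t i r z :
  search t i r = S z ->
  ext r (pr1 z) = true /\ halted (run (pr1 z) (pr2 z) (init i)) = true.
Proof. intros H; apply bmin_S in H; now apply andb_true_iff. Qed.

Lemma search_0 t i r r' s :
  search t i r = 0 -> pr r' s < t -> ext r r' = true ->
  halted (run r' s (init i)) = false.
Proof.
unfold search; rewrite bmin_0; intros H L E; specialize (H _ L).
now rewrite pr1_pr, pr2_pr, E in H.
Qed.

Lemma approx_S t n a d r :
  approx t (S n) a d = S r <->
  exists r', approx t n (Nat.div2 a) (Nat.div2 d) = S r' /\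
    if Nat.odd d
    then exists z, search t n (snoc r' (Nat.odd a)) = S z /\ r = pr1 z
    else r = snoc r' (Nat.odd a).
Proof.
cbn [approx]; unfold grow; destruct (approx t n _ _) as [|r']; cbn.
{ split; [easy|now intros (r' & ? & _)]. }
destruct (Nat.odd d).
- destruct (search t n (snoc r' (Nat.odd a))) as [|z] eqn:E; cbn.
  + split; [easy|intros (r'' & [= <-] & z & Hz & _)]; congruence.
  + split.
    * intros [= <-]; eauto.
    * intros (r'' & [= <-] & z' & Hz & ->); congruence.
- split; [intros [= <-]; eauto|intros (r'' & [= <-] & ->); reflexivity].
Qed.

(** A bounded search that has succeeded keeps its least witness at later stages, so a node once
    defined never changes. *)
Lemma approx_mono t t' n a d r :
  t <= t' -> approx t n a d = S r -> approx t' n a d = S r.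
Proof.
intros Ht; revert a d r; induction n as [|n IH]; intros a d r; [trivial|].
rewrite !approx_S; intros (r' & H & Hr); exists r'; split; [now apply IH|].
destruct (Nat.odd d); [|trivial].
destruct Hr as (z & Hz & Hr); exists z; split; [|trivial].
now apply bmin_mono with t.
Qed.

Lemma approx_unique t t' n a d r r' :
  approx t n a d = S r -> approx t' n a d = S r' -> r = r'.
Proof.
intros H H'; destruct (Nat.le_ge_cases t t') as [L|L];
  [apply (approx_mono _ _ _ _ _ _ L) in H|apply (approx_mono _ _ _ _ _ _ L) in H'];
  congruence.
Qed.

(** * The path of correct guesses and its limit *)

Definition forces (i r : nat) (p : bool * nat) : Prop :=
  if fst p then exists t z, search t i r = S z /\ snd p = pr1 z
  else snd p = r /\ forall t, search t i r = 0.

Lemma forces_total i r : exists p, forces i r p.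
Proof.
destruct (classic (exists t z, search t i r = S z)) as [(t & z & H)|H].
- exists (true, pr1 z); now exists t, z.
- exists (false, r); split; [trivial|]; intros t.
  destruct (search t i r) as [|z] eqn:E; [trivial|destruct H; eauto].
Qed.

Definition force (i r : nat) : bool * nat :=
  proj1_sig (constructive_indefinite_description _ (forces_total i r)).

Lemma force_spec i r : forces i r (force i r).
Proof. exact (proj2_sig (constructive_indefinite_description _ (forces_total i r))). Qed.

Fixpoint tau (a : nat -> bool) (n : nat) : nat :=
  match n with
  | 0 => pr 0 0
  | S n => snd (force n (snoc (tau a n) (a n)))
  end.

Definition guess (a : nat -> bool) (n : nat) : bool :=
  fst (force n (snoc (tau a n) (a n))).

(** The node at level [S k] has length at least [S k], so it already settles bit [k]. *)
Definition limit (a : nat -> bool) (k : nat) : bool := bit (tau a (S k)) k.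

Lemma ext_force i r : ext r (snd (force i r)) = true.
Proof.
generalize (force_spec i r); unfold forces; destruct (fst (force i r)).
- intros (t & z & Hz & ->); now apply search_S in Hz.
- intros [-> _]; apply ext_refl.
Qed.

Lemma ext_tau_snoc a n : ext (snoc (tau a n) (a n)) (tau a (S n)) = true.
Proof. apply ext_force. Qed.

Lemma ext_tau a n m : n <= m -> ext (tau a n) (tau a m) = true.
Proof.
induction 1 as [|m _ IH]; [apply ext_refl|].
eapply ext_trans; [exact IH|].
eapply ext_trans; [apply ext_snoc|apply ext_tau_snoc].
Qed.

Lemma length_tau a n : n <= pr1 (tau a n).
Proof.
induction n as [|n IH]; [lia|].
generalize (ext_tau_snoc a n); rewrite extP, length_snoc; lia.
Qed.

Lemma segment_tau a n : segment (limit a) (tau a n) = true.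
Proof.
apply segmentP; intros k Hk; unfold limit.
destruct (Nat.le_ge_cases n (S k)) as [L|L].
- symmetry; apply ext_bit; [now apply ext_tau|trivial].
- apply ext_bit; [now apply ext_tau|apply length_tau].
Qed.

(** The bit of the limit just after the node at level [n] is the coded bit [a n]; this is how [a] is
    decoded. *)
Lemma segment_tau_snoc a n a' :
  segment (limit a) (snoc (tau a n) a') = true -> a' = a n.
Proof.
generalize (ext_segment _ _ _ (ext_tau_snoc a n) (segment_tau a (S n))).
rewrite !segment_snoc, !andb_true_iff; intros [_ H] [_ H'].
now destruct a', (a n), (limit a (pr1 (tau a n))).
Qed.

(** The most significant digit comes first, so for a fixed length the order of numbers is the
    lexicographic order of sequences. *)
Fixpoint binary (f : nat -> bool) (n : nat) : nat :=
  match n with 0 => 0 | S n => 2 * binary f n + Nat.b2n (f n) end.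

Lemma binary_bound f n : binary f n < 2 ^ n.
Proof.
induction n as [|n IH]; cbn [binary Nat.pow]; [lia|destruct (f n); cbn [Nat.b2n]; lia].
Qed.

Lemma odd_binary f n : Nat.odd (binary f (S n)) = f n.
Proof.
cbn [binary]; rewrite Nat.odd_add, Nat.odd_mul; cbn; now destruct (f n).
Qed.

Lemma div2_binary f n : Nat.div2 (binary f (S n)) = binary f n.
Proof.
generalize (Nat.div2_odd (binary f (S n))); rewrite odd_binary; cbn [binary]; lia.
Qed.

Lemma approx_tau a n :
  exists t, approx t n (binary a n) (binary (guess a) n) = S (tau a n).
Proof.
induction n as [|n [t IH]]; [now exists 0|].
generalize (force_spec n (snoc (tau a n) (a n))); unfold forces.
change (fst (force n (snoc (tau a n) (a n)))) with (guess a n).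
destruct (guess a n) eqn:E.
(* The sum of the stages is late enough both for the previous node and for the new search. *)
- intros (t' & z & Hz & Hr); exists (t + t'); apply approx_S; exists (tau a n).
  rewrite !div2_binary, !odd_binary, E; split.
  + apply approx_mono with t; [lia|trivial].
  + exists z; split; [|exact Hr]; apply bmin_mono with t'; [lia|exact Hz].
- intros [Hr _]; exists t; apply approx_S; exists (tau a n).
  now rewrite !div2_binary, !odd_binary, E.
Qed.

(** A correct guess 1 converges and a wrong guess 1 diverges, so the correct
    guesses are lexicographically maximal among those compatible with the
    limit. *)
Lemma approx_guess a t n x d r :
  d < 2 ^ n -> approx t n x d = S r -> segment (limit a) r = true ->
  d <= binary (guess a) n /\ (d = binary (guess a) n -> r = tau a n).
Proof.
revert x d r; induction n as [|n IH]; intros x d r Hd H Hr.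
{ cbn in *; split; [lia|congruence]. }
apply approx_S in H; destruct H as (r' & H & Hz).
assert (He : ext (snoc r' (Nat.odd x)) r = true).
{ destruct (Nat.odd d); [|subst; apply ext_refl].
  destruct Hz as (z & Hz & ->); now apply search_S in Hz. }
assert (Hs := ext_segment _ _ _ He Hr).
assert (Hd2 := Nat.div2_odd d); cbn [Nat.pow] in Hd.
assert (Hr' := ext_segment _ _ _ (ext_snoc r' (Nat.odd x)) Hs).
destruct (IH _ (Nat.div2 d) _ ltac:(lia) H Hr') as [Hle Heq].
assert (Hb := Nat.b2n_le_1 (Nat.odd d)).
(* If the leading digits differ, they are strictly smaller by induction, and the last digit cannot
   make up for it. *)
cbn [binary]; destruct (Nat.eq_dec (Nat.div2 d) (binary (guess a) n)) as [E|E];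
  [|lia].
rewrite (Heq E) in *; apply segment_tau_snoc in Hs; rewrite Hs in *.
generalize (force_spec n (snoc (tau a n) (a n))); unfold forces.
change (fst (force n (snoc (tau a n) (a n)))) with (guess a n).
destruct (Nat.odd d).
- destruct Hz as (z & Hz & ->); destruct (guess a n).
  + intros (t' & z' & Hz' & Ht); split; [cbn [Nat.b2n]; lia|intros _].
    cbn [tau]; rewrite Ht; f_equal; exact (bmin_unique _ _ _ _ _ Hz Hz').
  (* A successful search contradicts a correct guess 0. *)
  + intros [_ H0]; congruence.
- destruct (guess a n); cbn [Nat.b2n] in *; [lia|].
  intros [Ht _]; split; [lia|]; now rewrite Hz.
Qed.

(** * Jump traceability *)

(** A computation converging with the limit as oracle halts on a long enough node of the path. Guess
    0 at level [n] is then impossible, and under guess 1 the node at level [S n] already makes it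
    halt, with the same value because the longer node extends it. *)
Lemma trace_value a X n v :
  decides (limit a) X -> J X n v ->
  exists s, run (tau a (S n)) s (init n) = pr v 0.
Proof.
intros HX (c & Hc & Hv); apply (eval_evaluates _ _ _ _ _ HX) in Hv.
rewrite Hc in Hv; destruct Hv as [L HL].
set (r := tau a (S n + L)).
destruct (HL r (segment_tau _ _)) with (K := 0) as [s Hs].
{ generalize (length_tau a (S n + L)); unfold r; lia. }
change (pr n (push n 0)) with (init n) in Hs.
assert (Hh : halted (run r s (init n)) = true)
  by (rewrite Hs; unfold halted; now rewrite pr2_pr).
assert (He : ext (tau a (S n)) r = true) by (apply ext_tau; lia).
generalize (force_spec n (snoc (tau a n) (a n))); unfold forces.
destruct (fst _).
- intros (t & z & Hz & Ht); exists (pr2 z).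
  apply search_S in Hz; destruct Hz as [_ Hz].
  rewrite <- Ht in Hz; rewrite <- (run_ext _ _ _ _ He Hz), <- Hs.
  apply run_unique; [now rewrite run_ext with (1 := He)|trivial].
- intros [_ H0]; exfalso.
  (* The stage [S (pr r s)] is the first whose bounded search covers the witness [pr r s]. *)
  assert (H := search_0 _ _ _ r s (H0 (S (pr r s)))).
  rewrite H in Hh; [discriminate|lia|].
  eapply ext_trans; [apply ext_tau_snoc|exact He].
Qed.

Lemma ensemble_ext (P Q : Ensemble nat) : (forall v, P v <-> Q v) -> P = Q.
Proof.
intros H; apply functional_extensionality; intros v.
apply propositional_extensionality, H.
Qed.

Lemma cardinal_list (l : list nat) (P : Ensemble nat) :
  (forall v, P v -> In v l) -> exists k, cardinal nat P k /\ k <= length l.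
Proof.
revert P; induction l as [|x l IH]; intros P HP.
- exists 0; split; [|trivial].
  rewrite (ensemble_ext P (Empty_set nat)); [constructor|].
  intros v; split; [intros H; destruct (HP v H)|intros []].
- destruct (IH (fun v => P v /\ v <> x)) as (k & Hk & Lk).
  { intros v [H N]; destruct (HP v H) as [E|E]; [now destruct N|exact E]. }
  destruct (classic (P x)) as [Hx|Hx].
  + exists (S k); split; [|cbn; lia].
    rewrite (ensemble_ext P (Ensembles.Add nat (fun v => P v /\ v <> x) x)).
    * constructor; [trivial|now intros []].
    * intros v; split.
      -- intros H; destruct (Nat.eq_dec v x) as [->|N];
           [now right|now left].
      -- now intros [? []|? []].
  + exists k; split; [|cbn; lia].
    rewrite (ensemble_ext P (fun v => P v /\ v <> x)); [trivial|].
    intros v; split; [|tauto]; intros H; split; congruence.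
Qed.

Lemma bounded_union (R : nat -> nat -> Prop) K M :
  (forall i, i < M -> exists l, length l <= K /\ forall v, R i v -> In v l) ->
  exists l, length l <= M * K /\ forall v, (exists i, i < M /\ R i v) -> In v l.
Proof.
induction M as [|M IH]; intros H.
- exists nil; split; [trivial|intros v (i & ? & _); lia].
- destruct IH as (l & Hl & Hv); [intros i Hi; apply H; lia|].
  destruct (H M (Nat.lt_succ_diag_r M)) as (l' & Hl' & Hv').
  exists (l' ++ l); rewrite length_app; split; [lia|].
  intros v (i & Hi & Hr); apply in_or_app.
  destruct (Nat.eq_dec i M) as [->|]; [left; auto|right].
  apply Hv; exists i; split; [lia|trivial].
Qed.

(** All digit sequences are tried, without reference to the path, which makes the trace enumerable
    without an oracle. The nesting of the bounded quantifiers fits two uses of [bounded_union]. *)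
Definition traced (n v : nat) : Prop :=
  exists a, a < 2 ^ S n /\ exists d, d < 2 ^ S n /\ exists t s r,
    approx t (S n) a d = S r /\ run r s (init n) = pr v 0.

Lemma traced_bound n :
  exists l, length l <= 2 ^ S n * 2 ^ S n /\ forall v, traced n v -> In v l.
Proof.
apply bounded_union; intros a _.
destruct (bounded_union (fun d v => exists t s r,
  approx t (S n) a d = S r /\ run r s (init n) = pr v 0) 1 (2 ^ S n))
  as (l & Hl & Hv); [intros d _|exists l; now rewrite Nat.mul_1_r in Hl].
(* For fixed digits the node is independent of the stage and its halting configuration is unique, so
   there is at most one value. *)
destruct (classic (exists v t s r,
  approx t (S n) a d = S r /\ run r s (init n) = pr v 0))
  as [(v & t & s & r & H & Hv)|N].
- exists (v :: nil); split; [trivial|].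
  intros v' (t' & s' & r' & H' & Hv'); left.
  rewrite <- (approx_unique _ _ _ _ _ _ _ H H') in Hv'.
  assert (E : pr v 0 = pr v' 0); [|now apply pr_inj in E].
  rewrite <- Hv, <- Hv'; apply run_unique; rewrite ?Hv, ?Hv';
    unfold halted; now rewrite pr2_pr.
- exists nil; split; [cbn; lia|]; intros v H; destruct N; eauto.
Qed.

Lemma effective_computable f : effective (fun _ => f) -> computable f.
Proof.
intros [c Hc]; exists (code_num c); intros n; exists c; split; [trivial|].
apply (Hc (fun _ => false)); intros k; easy.
Qed.

(** The ingredient for the parameter theorem: the tags 1, 2 and 6 are those of [Zero], [Succ] and
    [Comp]. *)
Lemma effective_code_const F :
  effective F -> effective (fun b x => code_num (const (F b x))).
Proof.
intros HF; apply effective_ext with (fun b x =>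
  nat_rect (fun _ => nat) (pr 1 0) (fun _ r => pr 6 (pr (pr 2 0) r)) (F b x)).
- intros b x; induction (F b x) as [|n IH]; cbn; congruence.
- apply effective_rec with (F := fun _ _ => pr 1 0)
    (G := fun _ _ _ r => pr 6 (pr (pr 2 0) r)); auto 10 with eff.
Qed.

#[local] Hint Resolve effective_code_const : eff.

Lemma traced_enumerable :
  exists c, forall n v, (exists y, eval (Empty_set nat) c (pr n v) y) <-> traced n v.
Proof.
destruct (effective_exists (fun _ x z =>
  let n := pr1 x in let v := pr2 x in
  let t := pr1 z in let s := pr1 (pr2 z) in
  let a := pr1 (pr2 (pr2 z)) in let d := pr2 (pr2 (pr2 z)) in
  (a <? 2 ^ S n) && (d <? 2 ^ S n) && negb (approx t (S n) a d =? 0) &&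
  (run (Nat.pred (approx t (S n) a d)) s (init n) =? pr v 0))) as [c Hc].
{ cbv zeta; unfold init; auto 40 with eff. }
exists c; intros n v; rewrite (Hc (fun _ => false)) by now intros k.
cbv zeta; rewrite pr1_pr, pr2_pr; split.
- intros [z Hz]; rewrite !andb_true_iff, !Nat.ltb_lt, Nat.eqb_eq in Hz.
  destruct Hz as [[[Ha Hd] H0] Hr].
  exists (pr1 (pr2 (pr2 z))); split; [trivial|].
  exists (pr2 (pr2 (pr2 z))); split; [trivial|].
  exists (pr1 z), (pr1 (pr2 z)); destruct (approx _ _ _ _) as [|r]; [easy|].
  now exists r.
- intros (a & Ha & d & Hd & t & s & r & H & Hr).
  exists (pr t (pr s (pr a d))); autorewrite with pr.
  rewrite !andb_true_iff, !Nat.ltb_lt, Nat.eqb_eq, H; auto.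
Qed.

Lemma limit_jump_traceable a X : decides (limit a) X -> jump_traceable X.
Proof.
intros HX; destruct traced_enumerable as [c Hc].
(* The index hardwires [n] into the enumeration of the trace. The bound is the number of pairs of
   digit sequences of length [S n]. *)
exists (fun n => code_num (Comp c (Pair (const n) Id))), (fun n => 2 ^ (S n + S n)).
assert (HW : forall n v,
  W (Empty_set nat) (code_num (Comp c (Pair (const n) Id))) v <-> traced n v).
{ intros n v; rewrite <- Hc; split.
  - intros (y & c' & Hn & Hy); apply code_num_inj in Hn; subst c'.
    destruct Hy as (u & (w & v' & Hw & Hv & ->) & Hy).
    apply eval_const in Hw; apply eval_Id in Hv; subst; eauto.
  - intros [y Hy]; exists y, (Comp c (Pair (const n) Id)); split; [trivial|].
    exists (pr n v); split; [|trivial]; exists n, v.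
    now rewrite eval_const, eval_Id. }
repeat apply conj.
- apply effective_computable; cbn [code_num]; auto 20 with eff.
- apply effective_computable; auto 20 with eff.
- intros n v Hv; apply HW; destruct (trace_value _ _ _ _ HX Hv) as [s Hs].
  destruct (approx_tau a (S n)) as [t Ht].
  exists (binary a (S n)); split; [apply binary_bound|].
  exists (binary (guess a) (S n)); split; [apply binary_bound|].
  now exists t, s, (tau a (S n)).
- intros n; destruct (traced_bound n) as (l & Hl & Hv).
  destruct (cardinal_list l (W (Empty_set nat)
    (code_num (Comp c (Pair (const n) Id))))) as (k & Hk & Lk).
  { intros v Hw; now apply Hv, HW. }
  exists k; split; [trivial|]; rewrite Nat.pow_add_r; lia.
Qed.

(** * Coding into the jump *)

(** The program with index [q x] discards its argument in favour of the constant [x], so applying it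
    to its own index still asks about [x]. The function [q] does not depend on the oracle. *)
Lemma jump_enumerable P :
  effective (fun b z => Nat.b2n (P b (pr1 z) (pr2 z))) ->
  exists q, effective (fun _ => q) /\ forall b X, decides b X -> forall x,
    jump X (q x) <-> exists z, P b x z = true.
Proof.
intros HP; destruct (effective_exists P HP) as [c Hc].
exists (fun x => code_num (Comp c (const x))); split.
{ cbn [code_num]; auto 10 with eff. }
intros b X HX x; rewrite <- (Hc b X HX); split.
- intros (y & c' & Hn & Hy); apply code_num_inj in Hn; subst c'.
  destruct Hy as (u & Hu & Hy); apply eval_const in Hu; subst; eauto.
- intros [y Hy]; exists y, (Comp c (const x)); split; [trivial|].
  exists x; now rewrite eval_const.
Qed.

(** [p m] and [q m] are the questions whether the guess [m] yields a segment of
    the oracle, and whether it yields one that is followed by a 1. *)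
Fixpoint last_true (p q : nat -> nat) (m : nat) : tt_cond :=
  match m with
  | 0 => TFalse
  | S m => TOr (TAtom (q m)) (TAnd (TNot (TAtom (p m))) (last_true p q m))
  end.

Lemma effective_last_true p q N :
  effective (fun _ => p) -> effective (fun _ => q) -> effective N ->
  effective (fun b x =>
    tt_num (last_true (fun m => p (pr x m)) (fun m => q (pr x m)) (N b x))).
Proof.
intros Hp Hq HN; apply effective_ext with (fun b x =>
  nat_rect (fun _ => nat) (pr 1 0) (fun m r =>
    pr 4 (pr (pr 0 (q (pr x m))) (pr 3 (pr (pr 2 (pr 0 (p (pr x m)))) r)))) (N b x)).
- intros b x; induction (N b x) as [|m IH]; cbn; congruence.
- apply effective_rec with (F := fun _ _ => pr 1 0) (G := fun b x m r =>
    pr 4 (pr (pr 0 (q (pr x m))) (pr 3 (pr (pr 2 (pr 0 (p (pr x m)))) r))));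
    [auto with eff| |trivial].
  assert (H := effective_pr _ _ (effective_pr1 _ effective_id)
    (effective_pr1 _ (effective_pr2 _ effective_id))).
  assert (Hp' := effective_comp _ _ Hp H).
  assert (Hq' := effective_comp _ _ Hq H).
  auto 20 with eff.
Qed.

(** Above [d] every question fails and the formula falls through to [d], where the positive answer
    to [p d] closes the remaining branch. *)
Lemma last_true_sat X p q d m :
  d < m -> X (p d) ->
  (forall i, d < i < m -> ~ X (p i) /\ ~ X (q i)) ->
  tt_sat X (last_true p q m) <-> X (q d).
Proof.
intros Hd Hp; induction m as [|m IH]; [lia|]; intros H; cbn.
destruct (Nat.eq_dec d m) as [->|]; [tauto|].
rewrite IH; [|lia|intros i Hi; apply H; lia].
destruct (H m) as [H1 H2]; [lia|tauto].
Qed.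

(** By [approx_guess] the correct guesses are the greatest [d] with a positive answer to [p]; there
    [q] reads the bit after the node, which is [a n]. *)
Lemma limit_jump_codes a X :
  decides (limit a) X -> tt_reducible (fun n => a n = true) (jump X).
Proof.
intros HX.
destruct (jump_enumerable (fun b x z =>
  let g := approx (pr1 z) (pr1 x) (pr2 z) (pr2 x) in
  (* The witness [z] holds the stage and the coded bits: the reduction does not know the latter, so
     they are quantified away. *)
  negb (g =? 0) && segment b (Nat.pred g))) as (p & Hp & Ep).
{ cbv zeta; auto 20 with eff. }
destruct (jump_enumerable (fun b x z =>
  let g := approx (pr1 z) (pr1 x) (pr2 z) (pr2 x) in
  negb (g =? 0) && segment b (snoc (Nat.pred g) true))) as (q & Hq & Eq).
{ cbv zeta; auto 20 with eff. }
assert (Jp : forall n d, jump X (p (pr n d)) <-> exists t x r,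
  approx t n x d = S r /\ segment (limit a) r = true).
{ intros n d; rewrite (Ep _ _ HX), pr1_pr, pr2_pr; cbv zeta; split.
  - intros [z Hz]; exists (pr1 z), (pr2 z).
    destruct (approx _ _ _ _) as [|r]; [easy|now exists r].
  - intros (t & x & r & H & Hr); exists (pr t x).
    now rewrite pr1_pr, pr2_pr, H. }
assert (Jq : forall n d, jump X (q (pr n d)) <-> exists t x r,
  approx t n x d = S r /\ segment (limit a) (snoc r true) = true).
{ intros n d; rewrite (Eq _ _ HX), pr1_pr, pr2_pr; cbv zeta; split.
  - intros [z Hz]; exists (pr1 z), (pr2 z).
    destruct (approx _ _ _ _) as [|r]; [easy|now exists r].
  - intros (t & x & r & H & Hr); exists (pr t x).
    now rewrite pr1_pr, pr2_pr, H. }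
clear Ep Eq.
(* There are [2 ^ n] guess sequences of length [n]. *)
exists (fun n => last_true (fun m => p (pr n m)) (fun m => q (pr n m)) (2 ^ n)).
split.
{ apply effective_computable, effective_last_true with (N := fun _ n => 2 ^ n);
    auto with eff. }
intros n; destruct (approx_tau a n) as [t Ht].
rewrite last_true_sat with (d := binary (guess a) n).
- rewrite Jq; split.
  + intros Ha; exists t, (binary a n), (tau a n); split; [trivial|].
    generalize (ext_segment _ _ _ (ext_tau_snoc a n) (segment_tau a (S n))).
    now rewrite Ha.
  + intros (t' & x & r & H & Hr).
    assert (Hs := ext_segment _ _ _ (ext_snoc r true) Hr).
    destruct (approx_guess _ _ _ _ _ _ (binary_bound _ _) H Hs) as [_ E].
    rewrite (E eq_refl) in Hr; symmetry; now apply segment_tau_snoc.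
- apply binary_bound.
- apply Jp; exists t, (binary a n), (tau a n); split; [trivial|apply segment_tau].
(* A positive answer to either question puts the node itself on the limit, which bounds [d] by the
   correct guesses. *)
- intros d Hd; rewrite Jp, Jq; split; intros (t' & x & r & H & Hr).
  + apply (approx_guess _ _ _ _ _ _ (proj2 Hd) H) in Hr; lia.
  + apply (ext_segment _ _ _ (ext_snoc r true)) in Hr.
    apply (approx_guess _ _ _ _ _ _ (proj2 Hd) H) in Hr; lia.
Qed.

Theorem theorem2p1 :
  exists B : Ensemble nat, superhigh B /\ jump_traceable B.
Proof.
set (A := jump (jump (Empty_set nat))).
set (a := fun n => if excluded_middle_informative (A n) then true else false).
assert (Ha : forall n, A n <-> a n = true)
  by (intros n; unfold a; destruct (excluded_middle_informative _); easy).
assert (HB : decides (limit a) (fun k => limit a k = true)) by easy.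
exists (fun k => limit a k = true); split.
- unfold superhigh; fold A; rewrite (ensemble_ext _ _ Ha).
  now apply limit_jump_codes.
- exact (limit_jump_traceable a _ HB).
Qed.
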